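(* (Soundness of QBUA$^\Diamond$ triples.) For all resource functions $P,Q$ and commands $C$, if $\vdash_{\mathsf B}^{\Diamond}[P]\,C\,[Q]$ is derivable with the QBUA$^\Diamond$ rules, then $\vDash_{\mathsf B}^{\Diamond}[P]\,C\,[Q]$ holds.
   Context: Commands over integer-valued program variables: $C ::= \mathsf{skip} \mid x:=e \mid \mathsf{assume}(B) \mid \mathsf{tick}(e) \mid C;C \mid C+C \mid C^\star \mid \mathsf{local}\ x\ \mathsf{in}\ C$ ($+$ nondeterministic choice, $C^\star$ nondeterministic iteration). States $\sigma:\mathit{Var}\to\mathbb Z$. Big-step semantics $\langle C,\sigma,p\rangle\Downarrow_l\langle\tau,q\rangle$ (resource $p$ at start, $q$ at end, $l$ minimal level seen): skip/assign/assume (assume requires $B$ true in $\sigma$) leave resource $p$ and have $l=p$; assign updates $x$ to $[\![e]\!]_\sigma$; tick: $\langle\mathsf{tick}(e),\sigma,p\rangle\Downarrow_{\min(p,p-[\![e]\!]_\sigma)}\langle\sigma,p-[\![e]\!]_\sigma\rangle$; seq composes runs with $l=\min(l_1,l_2)$; choice takes a run of either branch; $\langle C^\star,\sigma,p\rangle\Downarrow_p\langle\sigma,p\rangle$ and runs of $C;C^\star$ are runs of $C^\star$; local: from $\langle C,\sigma,p\rangle\Downarrow_l\langle\tau,q\rangle$ infer $\langle\mathsf{local}\ x\ \mathsf{in}\ C,\sigma[x\mapsto v],p\rangle\Downarrow_l\langle\tau[x\mapsto v],q\rangle$. $\Downarrow$ means $\exists l$; $\Downarrow^{\le0}$ means $\exists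 l\le 0$. Resource functions $P:\mathit{State}\to\mathbb Z\cup\{\pm\infty\}$; pointwise $\min,\max,+,-$; $\mathsf{Sup}\,x.P:=\lambda\sigma.\sup_v P(\sigma[x\mapsto v])$; $P\preceq Q$ pointwise $\le$; $[B](\sigma)=+\infty$ if $B$ holds, else $-\infty$; $\mathrm{fv}$, $\mathrm{mod}(C)$ free/modified variables. Semantics: $\vDash_{\mathsf B}^{\Diamond}[P]C[Q]$ iff for all $\sigma$ and $p\le P(\sigma)$ there exist $\tau$, $q\le Q(\tau)$ with $\langle C,\sigma,p\rangle\Downarrow^{\le0}\langle\tau,q\rangle$ (so $P(\sigma)$ under-approximates the high-water mark). QBUA rules ($\vdash_{\mathsf B}$, used as premises): $[P]\mathsf{skip}[P]$; $[P]\,x:=e\,[\mathsf{Sup}\,x'.\min(P[x'/x],[x=e[x'/x]])]$; $[\min(P,[B])]\mathsf{assume}(B)[\min(P,[B])]$; $[P]\mathsf{tick}(e)[P-e]$; seq; choice; loop (from $\forall n<k.[P(n)]C[P(n+1)]$ get $[P(0)]C^\star[P(k)]$); local with $\mathsf{Sup}$; disjunction giving $[\lambda\sigma.\sup_{i}P_i(\sigma)]C[\lambda\sigma.\sup_iQ_i(\sigma)]$; constancy with $\min(\cdot,[B])$ when $\mathrm{fv}(B)\cap\mathrm{mod}(C)=\emptyset$; relax $[P+F]C[Q+F]$ when $\mathrm{fv}(F)\cap\mathrm{mod}(C)=\emptyset$; consequence ($P\preceq P'$, $[P']C[Q']$, $Q'\preceq Q$); substitution ($y$ fresh). QBUA$^\Diamond$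 rules ($\vdash^\Diamond_{\mathsf B}$): if $P\preceq0$: $[P]\mathsf{skip}[P]$, $[P]\,x:=e\,[\mathsf{Sup}\,x'.\min(P[x'/x],[x=e[x'/x]])]$, $[\min(P,[B])]\mathsf{assume}(B)[\min(P,[B])]$, $[P]C^\star[P]$; if $\min(P,P-e)\preceq0$: $[P]\mathsf{tick}(e)[P-e]$; SeqL: from $\vdash^\Diamond_{\mathsf B}[P]C_1[R]$ and $\vdash_{\mathsf B}[R]C_2[Q]$ get $\vdash^\Diamond_{\mathsf B}[P]C_1;C_2[Q]$; SeqR: from $\vdash_{\mathsf B}[P]C_1[R]$ and $\vdash^\Diamond_{\mathsf B}[R]C_2[Q]$ likewise; choice from either branch; Loop: from $\forall n<k.\vdash_{\mathsf B}[P(n)]C[P(n+1)]$ and $\exists m<k.\vdash^\Diamond_{\mathsf B}[P(m)]C[P(m+1)]$ get $\vdash^\Diamond_{\mathsf B}[P(0)]C^\star[P(k)]$; local with $\mathsf{Sup}$; disjunction: from $\forall i\in I.[P_i]C[Q_i]$ get $[\lambda\sigma.\sup_{i\in I}P_i(\sigma)]C[\lambda\sigma.\sup_{i\in I}Q_i(\sigma)]$; constancy with $\min(\cdot,[B])$; relax $[P+F]C[Q+F]$ if $\mathrm{fv}(F)\cap\mathrm{mod}(C)=\emptyset$ and $F\preceq0$; consequence ($P\preceq P'$, $Q'\preceq Q$); substitution ($y\notin\mathrm{fv}(P)\cup\mathrm{fv}(Q)\cup\mathrm{fv}(C)$). *)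

(* Defs.v *)
From mathcomp Require Import all_boot all_order all_algebra.
From mathcomp Require Import boolp classical_sets constructive_ereal.
Set Implicit Arguments.
Unset Strict Implicit.
Unset Printing Implicit Defensive.
Import Order.TTheory GRing.Theory Num.Theory.

Local Open Scope classical_set_scope.
Local Open Scope ring_scope.

Definition var := nat.
Definition state := var -> int.

Definition upd (s : state) (x : var) (v : int) : state := [eta s with x |-> v].

(* Expressions are taken over an arbitrary language: all that matters is the
   denotation and the finite list of variables occurring in the expression.   *)
Record expr (T : Type) := Expr {
  eval :> state -> T;
  efv : seq var;
  eval_efv : forall s t : state, {in efv, s =1 t} -> eval s = eval t }.

Definition aexpr := expr int.
Definition bexpr := expr bool.

Lemma eren_subproof T (f : var -> var) (e : expr T) (s t : state) :
  {in map f (efv e), s =1 t} -> e (s \o f) = e (t \o f).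
Proof. by move=> st; apply: eval_efv => x xe /=; apply/st/map_f. Qed.

Definition eren T (f : var -> var) (e : expr T) : expr T :=
  @Expr T (fun s => e (s \o f)) (map f (efv e)) (@eren_subproof T f e).

Inductive cmd :=
| Skip
| Assign (x : var) (e : aexpr)
| Assume (B : bexpr)
| Tick (e : aexpr)
| Seq (C1 C2 : cmd)
| Choice (C1 C2 : cmd)
| Star (C : cmd)
| LocalIn (x : var) (C : cmd).

Fixpoint cfv (C : cmd) : seq var :=
  match C with
  | Skip => [::]
  | Assign x e => x :: efv e
  | Assume B => efv B
  | Tick e => efv e
  | Seq C1 C2 | Choice C1 C2 => cfv C1 ++ cfv C2
  | Star C => cfv C
  | LocalIn x C => [seq y <- cfv C | y != x]
  end.

Fixpoint cmod (C : cmd) : seq var :=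
  match C with
  | Assign x _ => [:: x]
  | Seq C1 C2 | Choice C1 C2 => cmod C1 ++ cmod C2
  | Star C => cmod C
  | LocalIn x C => [seq y <- cmod C | y != x]
  | Skip | Assume _ | Tick _ => [::]
  end.

Definition fresh (xs : seq var) : var := (\max_(x <- xs) x).+1.

(* Capture-avoiding simultaneous renaming of the free variables along f: the
   bound variable of a local block is renamed only when it would capture.     *)
Fixpoint cren (f : var -> var) (C : cmd) : cmd :=
  match C with
  | Skip => Skip
  | Assign x e => Assign (f x) (eren f e)
  | Assume B => Assume (eren f B)
  | Tick e => Tick (eren f e)
  | Seq C1 C2 => Seq (cren f C1) (cren f C2)
  | Choice C1 C2 => Choice (cren f C1) (cren f C2)
  | Star C => Star (cren f C)
  | LocalIn x C =>
      let avoid := map f [seq y <- cfv C | y != x] in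
      let x' := if x \in avoid then fresh avoid else x in
      LocalIn x' (cren [eta f with x |-> x'] C)
  end.

(* C[y/x] *)
Definition csubst (C : cmd) (x y : var) : cmd := cren [eta id with x |-> y] C.

(* run C s p l t q is <C, s, p> \Downarrow_l <t, q> *)
Inductive run : cmd -> state -> int -> int -> state -> int -> Prop :=
| run_skip s p : run Skip s p p s p
| run_assign x (e : aexpr) s p : run (Assign x e) s p p (upd s x (e s)) p
| run_assume (B : bexpr) s p : B s -> run (Assume B) s p p s p
| run_tick (e : aexpr) s p :
    run (Tick e) s p (Order.min p (p - e s)) s (p - e s)
| run_seq C1 C2 s p l1 r k l2 t q :
    run C1 s p l1 r k -> run C2 r k l2 t q ->
    run (Seq C1 C2) s p (Order.min l1 l2) t q
| run_choiceL C1 C2 s p l t q :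
    run C1 s p l t q -> run (Choice C1 C2) s p l t q
| run_choiceR C1 C2 s p l t q :
    run C2 s p l t q -> run (Choice C1 C2) s p l t q
| run_star0 C s p : run (Star C) s p p s p
| run_starS C s p l t q :
    run (Seq C (Star C)) s p l t q -> run (Star C) s p l t q
| run_local x C s p l t q v :
    run C s p l t q -> run (LocalIn x C) (upd s x v) p l (upd t x v) q.

Definition run_le0 (C : cmd) (s : state) (p : int) (t : state) (q : int) :=
  exists2 l : int, l <= 0 & run C s p l t q.

Local Open Scope ereal_scope.

Definition rfun := state -> \bar int.

Definition rle (P Q : rfun) := forall s, P s <= Q s.

Definition ind (B : state -> bool) : rfun := fun s => if B s then +oo else -oo.

Definition rsup (I : Type) (P : I -> rfun) : rfun :=
  fun s => supremum -oo (range (fun i => P i s)).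

(* F[v/x], for a value v *)
Definition vsubst T (F : state -> T) (x : var) (v : int) : state -> T :=
  fun s => F (upd s x v).

(* F[y/x], for a variable y *)
Definition rsubst T (F : state -> T) (x y : var) : state -> T :=
  fun s => F (upd s x (s y)).

Definition Sup (x : var) (P : rfun) : rfun := rsup (vsubst P x).

Definition fv (P : rfun) : set var :=
  [set x | exists s v, P (upd s x v) <> P s].

(* Sup x'. min (P[x'/x], [x = e[x'/x]]), the bound x' being rendered by the
   value v over which the supremum ranges; see assign_postE.                  *)
Definition assign_post (x : var) (e : aexpr) (P : rfun) : rfun :=
  rsup (fun v : int =>
    vsubst P x v \min ind (fun s => s x == vsubst e x v s)).

Lemma assign_postE (x x' : var) (e : aexpr) (P : rfun) :
  x' <> x -> ~ fv P x' -> x' \notin efv e ->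
  assign_post x e P =
  Sup x' (rsubst P x x' \min ind (fun s => s x == rsubst e x x' s)).
Proof.
move=> /eqP x'x Px' ex'; apply/funext => s; rewrite /assign_post /Sup /rsup.
suff E : (fun v : int => (vsubst P x v \min
      ind (fun s => s x == vsubst e x v s)) s) =
    (fun v : int => vsubst (rsubst P x x' \min
      ind (fun s => s x == rsubst e x x' s)) x' v s) by rewrite E.
apply/funext => v; rewrite /vsubst /rsubst /ind /=.
have -> : upd (upd s x' v) x (upd s x' v x') = upd (upd s x v) x' v.
  apply/funext => y; rewrite /upd /= eqxx; case: eqP => [->|//].
  by rewrite eq_sym (negbTE x'x).
have -> : upd s x' v x = s x by rewrite /upd /= eq_sym (negbTE x'x).
have -> : P (upd (upd s x v) x' v) = P (upd s x v).
  by apply: contrapT => H; apply: Px'; exists (upd s x v), v.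
suff -> : e (upd (upd s x v) x' v) = e (upd s x v) by [].
apply: eval_efv => y ye; rewrite {1}/upd /=; case: eqP => // yx'.
by rewrite -yx' ye in ex'.
Qed.

(* derB is QBUA, derD is QBUA^\Diamond. P \+ F uses adde, for which
   +oo + -oo = -oo; the opposite convention would make derB_relax unsound.    *)
Inductive derB : rfun -> cmd -> rfun -> Prop :=
| derB_skip P : derB P Skip P
| derB_assign P x e : derB P (Assign x e) (assign_post x e P)
| derB_assume (P : rfun) (B : bexpr) :
    derB (P \min ind B) (Assume B) (P \min ind B)
| derB_tick (P : rfun) (e : aexpr) :
    derB P (Tick e) (fun s => P s - (e s)%:E)
| derB_seq P R Q C1 C2 : derB P C1 R -> derB R C2 Q -> derB P (Seq C1 C2) Q
| derB_choiceL P Q C1 C2 : derB P C1 Q -> derB P (Choice C1 C2) Q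
| derB_choiceR P Q C1 C2 : derB P C2 Q -> derB P (Choice C1 C2) Q
| derB_loop (P : nat -> rfun) (k : nat) C :
    (forall n, (n < k)%N -> derB (P n) C (P n.+1)) ->
    derB (P 0%N) (Star C) (P k)
| derB_local P Q x C : derB P C Q -> derB (Sup x P) (LocalIn x C) (Sup x Q)
| derB_disj (I : Type) (P Q : I -> rfun) C :
    (forall i, derB (P i) C (Q i)) -> derB (rsup P) C (rsup Q)
| derB_constancy P Q C (B : bexpr) :
    [set` efv B] `&` [set` cmod C] = set0 -> derB P C Q ->
    derB (P \min ind B) C (Q \min ind B)
| derB_relax P Q C (F : rfun) :
    fv F `&` [set` cmod C] = set0 -> derB P C Q -> derB (P \+ F) C (Q \+ F)
| derB_conseq P P' Q Q' C :
    rle P P' -> derB P' C Q' -> rle Q' Q -> derB P C Q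
| derB_subst P Q C x y :
    ~ fv P y -> ~ fv Q y -> y \notin cfv C -> derB P C Q ->
    derB (rsubst P x y) (csubst C x y) (rsubst Q x y).

Inductive derD : rfun -> cmd -> rfun -> Prop :=
| derD_skip P : rle P (fun=> 0) -> derD P Skip P
| derD_assign P x e :
    rle P (fun=> 0) -> derD P (Assign x e) (assign_post x e P)
| derD_assume (P : rfun) (B : bexpr) :
    rle P (fun=> 0) -> derD (P \min ind B) (Assume B) (P \min ind B)
| derD_star0 P C : rle P (fun=> 0) -> derD P (Star C) P
| derD_tick (P : rfun) (e : aexpr) :
    rle (P \min (fun s => P s - (e s)%:E)) (fun=> 0) ->
    derD P (Tick e) (fun s => P s - (e s)%:E)
| derD_seqL P R Q C1 C2 : derD P C1 R -> derB R C2 Q -> derD P (Seq C1 C2) Q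
| derD_seqR P R Q C1 C2 : derB P C1 R -> derD R C2 Q -> derD P (Seq C1 C2) Q
| derD_choiceL P Q C1 C2 : derD P C1 Q -> derD P (Choice C1 C2) Q
| derD_choiceR P Q C1 C2 : derD P C2 Q -> derD P (Choice C1 C2) Q
| derD_loop (P : nat -> rfun) (k m : nat) C :
    (forall n, (n < k)%N -> derB (P n) C (P n.+1)) ->
    (m < k)%N -> derD (P m) C (P m.+1) ->
    derD (P 0%N) (Star C) (P k)
| derD_local P Q x C : derD P C Q -> derD (Sup x P) (LocalIn x C) (Sup x Q)
| derD_disj (I : Type) (P Q : I -> rfun) C :
    (forall i, derD (P i) C (Q i)) -> derD (rsup P) C (rsup Q)
| derD_constancy P Q C (B : bexpr) :
    [set` efv B] `&` [set` cmod C] = set0 -> derD P C Q ->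
    derD (P \min ind B) C (Q \min ind B)
| derD_relax P Q C (F : rfun) :
    fv F `&` [set` cmod C] = set0 -> rle F (fun=> 0) -> derD P C Q ->
    derD (P \+ F) C (Q \+ F)
| derD_conseq P P' Q Q' C :
    rle P P' -> derD P' C Q' -> rle Q' Q -> derD P C Q
| derD_subst P Q C x y :
    ~ fv P y -> ~ fv Q y -> y \notin cfv C -> derD P C Q ->
    derD (rsubst P x y) (csubst C x y) (rsubst Q x y).

Definition validD (P : rfun) (C : cmd) (Q : rfun) : Prop :=
  forall (s : state) (p : int), p%:E <= P s ->
  exists (t : state) (q : int), q%:E <= Q t /\ run_le0 C s p t q.

(* Main.v *)
From mathcomp Require Import all_boot all_order all_algebra zify.
From mathcomp Require Import boolp classical_sets constructive_ereal.
Require Import Defs.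
Set Implicit Arguments.
Unset Strict Implicit.
Unset Printing Implicit Defensive.
Import Order.TTheory GRing.Theory Num.Theory.

Local Open Scope classical_set_scope.
Local Open Scope ring_scope.
Local Open Scope ereal_scope.

(** Both calculi are sound for one notion of validity, parametrised by the set
    of admissible minimal levels: all integers for QBUA, the nonpositive ones
    for QBUA^\Diamond. Three facts carry the argument. Runs can be shifted in
    the resource component, which gives relax. An integer lies below a
    supremum in [\bar int] iff it lies below one of its members, because a
    bounded set of integers has a maximum; this gives disjunction, local and
    assignment. Runs can be transported along a renaming that is injective on
    the free variables of the command, which gives substitution. *)

(** * Suprema in the integers extended with infinities *)

Lemma lt_EFin_int (p : int) (x : \bar int) : x < p%:E -> x <= (p - 1)%:E.
Proof. by case: x => [m| |] //; rewrite ?leNye // lte_fin lee_fin; lia. Qed.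

(** Without an integer upper bound the supremum is [+oo]. Below an integer bound [n], the member
    [n - k] at least distance [k] is a maximum. *)
Lemma int_supremums_neq0 (A : set (\bar int)) : supremums A !=set0.
Proof.
have [[n ubn]|unbounded] := pselect (exists n : int, ubound A n%:E); last first.
  exists +oo; split=> [x _|y uby]; first exact: leey.
  case: y uby => [m ubm| //|ubNy]; first by case: unbounded; exists m.
  by case: unbounded; exists 0%R => x /ubNy /le_trans; apply; exact: leNye.
have [exk|nofin] := pselect (exists k : nat, `[<A (n - k%:Z)%:E>]).
  case: (ex_minnP exk) => k /asboolP Ak mink.
  exists (n - k%:Z)%:E; split=> [x Ax|y]; last exact.
  case: x Ax => [m Am|/ubn //|_]; last exact: leNye.
  have mn : (m <= n)%R by rewrite -lee_fin ubn.
  have /mink : `[<A (n - `|n - m|%N%:Z)%:E>].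
    by apply/asboolP; rewrite (_ : (n - _ = m)%R) //; lia.
  by rewrite lee_fin; lia.
(* No integer belongs to [A] here, so [-oo] is its only possible member. *)
exists -oo; split=> [x Ax|y _]; last exact: leNye.
case: x Ax => [m Am|/ubn //|//].
have mn : (m <= n)%R by rewrite -lee_fin ubn.
case: nofin; exists `|n - m|%N.
by apply/asboolP; rewrite (_ : (n - _ = m)%R) //; lia.
Qed.

(** If no member reaches [p], discreteness makes [p - 1] an upper bound, hence also a bound on the
    supremum. *)
Lemma le_rsup (I : Type) (P : I -> rfun) (s : state) (p : int) :
  p%:E <= rsup P s <-> exists i, p%:E <= P i s.
Proof.
split=> [|[i pPi]]; last first.
  apply: le_trans pPi _.
  by apply: ge_supremum_Nmem; [exact: int_supremums_neq0|exists i].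
(* For an empty index type the supremum takes its default value [-oo], which is above no integer. *)
rewrite /rsup /supremum; case: ifPn => [_|_ psup]; first by rewrite leeNy_eq.
apply: contrapT => noi; have [_ lb] := xgetPex -oo (int_supremums_neq0 (range (P^~ s))).
suff /lb /(le_trans psup) : ubound (range (P^~ s)) (p - 1)%:E.
  by rewrite lee_fin; lia.
move=> _ [i _ <-]; apply: lt_EFin_int; rewrite ltNge; apply/negP => pPi.
by apply: noi; exists i.
Qed.

(** * States, free variables, and what runs preserve *)

Lemma upd_id (s : state) (x : var) : upd s x (s x) = s.
Proof. by apply/funext => y; rewrite /upd /=; case: eqP => // ->. Qed.

Lemma upd_upd (s : state) (x : var) (u v : int) : upd (upd s x u) x v = upd s x v.
Proof. by apply/funext => y; rewrite /upd /=; case: eqP. Qed.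

Lemma upd_eq (s : state) (x : var) (v : int) : upd s x v x = v.
Proof. by rewrite /upd /= eqxx. Qed.

Lemma upd_neq (s : state) (x y : var) (v : int) : y != x -> upd s x v y = s y.
Proof. by rewrite /upd /=; case: eqP. Qed.

(** [fv] only speaks of changing one variable at a time; since [xs] is finite, [s] can be turned
    into [t] by successive single updates. *)
Lemma fv_indep (F : rfun) (xs : seq var) (s t : state) :
  fv F `&` [set` xs] = set0 -> (forall y, y \notin xs -> t y = s y) -> F t = F s.
Proof.
elim: xs s => [|x xs IH] s disj st.
  by congr F; apply/funext => y; exact: st.
have nfv y : y \in x :: xs -> ~ fv F y.
  by move=> yxs Fy; suff: (set0 : set var) y by []; rewrite -disj.
have -> : F s = F (upd s x (t x)).
  apply: contrapT => Fne; apply: (nfv x); first exact: mem_head.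
  by exists s, (t x); exact/nesym.
apply: IH => [|y yxs]; first by rewrite -subset0 => y -[Fy yxs];
  apply: (nfv y) => //; rewrite inE; apply/orP; right.
have [->|yx] := eqVneq y x; first by rewrite upd_eq.
by rewrite upd_neq // st // inE (negbTE yx).
Qed.

Lemma cmod_cfv (C : cmd) : {subset cmod C <= cfv C}.
Proof.
elim: C => //= [x e y|C1 IH1 C2 IH2 y|C1 IH1 C2 IH2 y|x C IH y].
- by rewrite !inE => ->.
- by rewrite !mem_cat => /orP[/IH1|/IH2] ->; rewrite ?orbT.
- by rewrite !mem_cat => /orP[/IH1|/IH2] ->; rewrite ?orbT.
- by rewrite !mem_filter => /andP[-> /IH].
Qed.

Lemma run_frame (C : cmd) (s t : state) (p l q : int) :
  run C s p l t q -> forall y, y \notin cmod C -> t y = s y.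
Proof.
elim=> //= {C s p l t q}.
- by move=> x e s p y; rewrite inE => yx; rewrite upd_neq.
- move=> C1 C2 s p l1 r k l2 t q _ IH1 _ IH2 y; rewrite mem_cat => /norP[y1 y2].
  by rewrite IH2 // IH1.
- by move=> C1 C2 s p l t q _ IH y; rewrite mem_cat => /norP[y1 _]; exact: IH.
- by move=> C1 C2 s p l t q _ IH y; rewrite mem_cat => /norP[_ y2]; exact: IH.
- by move=> C s p l t q _ IH y yC; apply: IH; rewrite mem_cat negb_or yC.
- move=> x C s p l t q v _ IH y; rewrite mem_filter.
  have [->|yx] := eqVneq y x; first by rewrite !upd_eq.
  by rewrite !upd_neq //= => /IH.
Qed.

(** No command tests the resource, and translation by [d] commutes with [min] and with the
    subtraction made by a tick. *)
Lemma run_shift (C : cmd) (s t : state) (p l q d : int) :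
  run C s p l t q -> run C s (p + d)%R (l + d)%R t (q + d)%R.
Proof.
elim=> {C s p l t q}.
- by move=> s p; exact: run_skip.
- by move=> x e s p; exact: run_assign.
- by move=> B s p Bs; exact: run_assume.
- by move=> e s p; rewrite addr_minl addrAC; exact: run_tick.
- move=> C1 C2 s p l1 r k l2 t q _ IH1 _ IH2.
  by rewrite addr_minl; exact: run_seq IH1 IH2.
- by move=> C1 C2 s p l t q _; exact: run_choiceL.
- by move=> C1 C2 s p l t q _; exact: run_choiceR.
- by move=> C s p; exact: run_star0.
- by move=> C s p l t q _; exact: run_starS.
- by move=> x C s p l t q v _; exact: run_local.
Qed.

(** * Transport of runs along renamings *)

Lemma fresh_notin (xs : seq var) : fresh xs \notin xs.
Proof.
apply/negP => /(@leq_bigmax_seq _ xs xpredT id) /(_ isT).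
by rewrite /fresh ltnn.
Qed.

(** [V] may exceed the free variables of [C], because a postcondition can depend on more of the
    state. The final clause, that nothing outside the renamed free variables changes, recovers
    agreement on this excess when a local block forces a smaller [V]. *)
Lemma run_cren (C : cmd) (s t : state) (p l q : int) : run C s p l t q ->
  forall (f : var -> var) (V : {pred var}) (s' : state),
    {subset cfv C <= V} -> {in V &, injective f} -> {in V, s =1 s' \o f} ->
  exists t', [/\ run (cren f C) s' p l t' q, {in V, t =1 t' \o f} &
                 forall w, w \notin map f (cfv C) -> t' w = s' w].
Proof.
elim=> {C s p l t q} /=.
- by move=> s p f V s' _ _ ss'; exists s'; split=> //; exact: run_skip.
- move=> x e s p f V s' sub finj ss'.
  have es : e s = eren f e s'.
    by apply: eval_efv => y ye; apply/ss'/sub; rewrite inE ye orbT.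
  exists (upd s' (f x) (e s)); split.
  + by rewrite es; exact: run_assign.
  + move=> y yV /=; have [->|yx] := eqVneq y x; first by rewrite !upd_eq.
    rewrite !upd_neq //; first exact: ss'.
    by apply: contra_neq yx => /finj; apply=> //; apply: sub; exact: mem_head.
  + by move=> w; rewrite inE negb_or => /andP[wx _]; rewrite upd_neq.
- move=> B s p Bs f V s' sub _ ss'; exists s'; split=> //.
  have Bs' : B s = eren f B s' by apply: eval_efv => y yB; exact/ss'/sub.
  by apply: run_assume; rewrite -Bs'.
- move=> e s p f V s' sub _ ss'; exists s'; split=> //.
  have -> : e s = eren f e s' by apply: eval_efv => y ye; exact/ss'/sub.
  exact: run_tick.
- move=> C1 C2 s p l1 r k l2 t q _ IH1 _ IH2 f V s' sub finj ss'.
  have sub1 : {subset cfv C1 <= V}.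
    by move=> y yC; apply: sub; rewrite mem_cat yC.
  have sub2 : {subset cfv C2 <= V}.
    by move=> y yC; apply: sub; rewrite mem_cat yC orbT.
  have [r' [run1 rr' out1]] := IH1 f V s' sub1 finj ss'.
  have [t' [run2 tt' out2]] := IH2 f V r' sub2 finj rr'.
  exists t'; split=> //; first exact: run_seq run1 run2.
  by move=> w; rewrite map_cat mem_cat => /norP[w1 w2]; rewrite out2 // out1.
- move=> C1 C2 s p l t q _ IH f V s' sub finj ss'.
  have sub1 : {subset cfv C1 <= V}.
    by move=> y yC; apply: sub; rewrite mem_cat yC.
  have [t' [run1 tt' out1]] := IH f V s' sub1 finj ss'.
  exists t'; split=> //; first exact: run_choiceL.
  by move=> w; rewrite map_cat mem_cat => /norP[w1 _]; exact: out1.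
- move=> C1 C2 s p l t q _ IH f V s' sub finj ss'.
  have sub2 : {subset cfv C2 <= V}.
    by move=> y yC; apply: sub; rewrite mem_cat yC orbT.
  have [t' [run2 tt' out2]] := IH f V s' sub2 finj ss'.
  exists t'; split=> //; first exact: run_choiceR.
  by move=> w; rewrite map_cat mem_cat => /norP[_ w2]; exact: out2.
- by move=> C s p f V s' _ _ ss'; exists s'; split=> //; exact: run_star0.
- move=> C s p l t q _ IH f V s' sub finj ss'.
  have subC : {subset cfv C ++ cfv C <= V}.
    by move=> y; rewrite mem_cat orbb; exact: sub.
  have [t' [runC tt' out]] := IH f V s' subC finj ss'.
  exists t'; split=> //; first exact: run_starS.
  by move=> w wC; apply: out; rewrite map_cat mem_cat orbb.
- move=> x C s p l t q v runC IH f V s' sub finj ss'.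
  set avoid := map f _; set x' := if _ then _ else _.
  have x'out : x' \notin avoid by rewrite /x'; case: ifPn => // _; exact: fresh_notin.
  have inV y : y \in cfv C -> y != x -> y \in V.
    by move=> yC yx; apply: sub; rewrite mem_filter yx.
  have favoid y : y \in cfv C -> y != x -> f y \in avoid.
    by move=> yC yx; apply: map_f; rewrite mem_filter yx.
  have fx' y : y \in cfv C -> y != x -> f y != x'.
    by move=> yC yx; apply: contraNneq x'out => <-; exact: favoid.
  set g := (X in cren X C).
  have gx : g x = x' by rewrite /g /= eqxx.
  have gy y : y != x -> g y = f y by rewrite /g /=; case: eqP.
  clearbody g.
  have ginj : {in cfv C &, injective g}.
    move=> y z yC zC; have [->|yx] := eqVneq y x; have [->|zx] := eqVneq z x => //.
    + by rewrite gx gy // => /esym/eqP; rewrite (negbTE (fx' _ zC zx)).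
    + by rewrite gx gy // => /eqP; rewrite (negbTE (fx' _ yC yx)).
    + by rewrite !gy // => /finj; apply; exact: inV.
  have sg : {in cfv C, s =1 upd s' x' (s x) \o g}.
    move=> y yC /=; have [->|yx] := eqVneq y x; first by rewrite gx upd_eq.
    rewrite gy // upd_neq ?fx' //.
    by have /= <- := ss' y (inV y yC yx); rewrite upd_neq.
  (* [V] shrinks to [cfv C]: the new bound variable [x'] may be the image under [f] of a variable of
     [V] not free in the body, so [g] need not be injective on [V]. *)
  have [t' [runC' tg out]] := IH g (mem (cfv C)) _ (fun=> id) ginj sg.
  have out' w : w \notin avoid -> upd t' x' (s' x') w = s' w.
    move=> wa; have [->|wx'] := eqVneq w x'; first by rewrite upd_eq.
    rewrite upd_neq // out ?upd_neq //; apply/mapP => -[y yC wE].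
    move: wE wx' wa; have [->|yx] := eqVneq y x; first by rewrite gx => ->; rewrite eqxx.
    by rewrite gy // => -> _; rewrite favoid.
  exists (upd t' x' (s' x')); split=> //.
  (* To fit [run_local], [s'] is written as the start state of the body with its block variable
     reset to the outer value [s' x']. *)
  + rewrite -[X in run _ X](upd_id s' x') -(upd_upd s' x' (s x)).
    exact: run_local.
  + move=> y yV /=.
    have [yC|yC] := boolP (y \in [seq z <- cfv C | z != x]).
      move: yC; rewrite mem_filter => /andP[yx yC].
      by rewrite !upd_neq ?fx' // tg //= gy.
    (* A variable of [V] not free in the block is untouched by both runs: by injectivity its image
       avoids [avoid], and the source run frames it. *)
    rewrite out'; last first.
      apply/mapP => -[z zC /finj yz]; move: yC; rewrite yz ?zC //; exact: sub.
    have /= <- := ss' y yV.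
    by apply: (run_frame (run_local x v runC)); apply: contra yC; exact: cmod_cfv (LocalIn x C) _.
Qed.

(** * Validity relative to a set of levels, rule by rule *)

Definition valid (L : int -> Prop) (P : rfun) (C : cmd) (Q : rfun) : Prop :=
  forall (s : state) (p : int), p%:E <= P s ->
  exists t q l, [/\ q%:E <= Q t, L l & run C s p l t q].

Definition anylevel (_ : int) : Prop := True.
Definition nonpos (l : int) : Prop := (l <= 0)%R.

Section Validity.
Variable L : int -> Prop.
Implicit Types (P Q : rfun) (C : cmd).

(** A command that keeps the resource has its starting resource as minimal level, so this is the
    side condition that [P] be nonpositive, restated for a general [L]. *)
Definition admits P := forall s p, p%:E <= P s -> L p.

Lemma valid_skip P : admits P -> valid L P Skip P.
Proof.
by move=> LP s p pP; exists s, p, p; split=> //; [exact: LP pP|exact: run_skip].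
Qed.

Lemma valid_assign P (x : var) (e : aexpr) :
  admits P -> valid L P (Assign x e) (assign_post x e P).
Proof.
move=> LP s p pP; exists (upd s x (e s)), p, p.
split; [|exact: LP pP|exact: run_assign].
(* The witness is the old value of [x]: writing it back recovers [s]. *)
apply/le_rsup; exists (s x).
by rewrite /= /vsubst /ind upd_upd upd_id upd_eq eqxx le_min pP leey.
Qed.

Lemma valid_assume P (B : bexpr) :
  admits P -> valid L (P \min ind B) (Assume B) (P \min ind B).
Proof.
move=> LP s p pPB; have := pPB; rewrite /= le_min /ind => /andP[pP].
case: ifPn => [Bs _|_]; last by rewrite leeNy_eq.
by exists s, p, p; split=> //; [exact: LP pP|exact: run_assume].
Qed.

Lemma valid_star0 P C : admits P -> valid L P (Star C) P.
Proof.
by move=> LP s p pP; exists s, p, p; split=> //; [exact: LP pP|exact: run_star0].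
Qed.

Lemma valid_tick P (e : aexpr) :
  (forall s p, p%:E <= P s -> L (Order.min p (p - e s)%R)) ->
  valid L P (Tick e) (fun s => P s - (e s)%:E).
Proof.
move=> LP s p pP; exists s, (p - e s)%R, (Order.min p (p - e s)%R).
split; [|exact: LP|exact: run_tick].
by rewrite EFinB leeD2r.
Qed.

(** Separate level sets for the two halves let this cover plain sequencing, both variants with one
    low half, and the unfolding of loops. *)
Lemma valid_seq (L1 L2 : int -> Prop) P R Q C1 C2 :
  (forall l1 l2, L1 l1 -> L2 l2 -> L (Order.min l1 l2)) ->
  valid L1 P C1 R -> valid L2 R C2 Q -> valid L P (Seq C1 C2) Q.
Proof.
move=> Lmin v1 v2 s p /v1[r [k [l1 [kR L1l run1]]]].
have [t [q [l2 [qQ L2l run2]]]] := v2 r k kR.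
by exists t, q, (Order.min l1 l2); split=> //; [exact: Lmin|exact: run_seq run1 run2].
Qed.

Lemma valid_choiceL P Q C1 C2 : valid L P C1 Q -> valid L P (Choice C1 C2) Q.
Proof.
by move=> v s p /v[t [q [l [? ? r]]]]; exists t, q, l; split=> //; exact: run_choiceL.
Qed.

Lemma valid_choiceR P Q C1 C2 : valid L P C2 Q -> valid L P (Choice C1 C2) Q.
Proof.
by move=> v s p /v[t [q [l [? ? r]]]]; exists t, q, l; split=> //; exact: run_choiceR.
Qed.

Lemma valid_starS P Q C : valid L P (Seq C (Star C)) Q -> valid L P (Star C) Q.
Proof.
by move=> v s p /v[t [q [l [? ? r]]]]; exists t, q, l; split=> //; exact: run_starS.
Qed.

Lemma valid_local P Q C (x : var) :
  valid L P C Q -> valid L (Sup x P) (LocalIn x C) (Sup x Q).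
Proof.
move=> vC s p /le_rsup[v /vC[t [q [l [qQ Ll r]]]]].
exists (upd t x (s x)), q, l; split=> //.
  (* The block restores [s x] on exit, so the supremum is witnessed by the inner final value of
     [x]. *)
  by apply/le_rsup; exists (t x); rewrite /vsubst upd_upd upd_id.
by rewrite -[X in run _ X](upd_id s x) -(upd_upd s x v); exact: run_local.
Qed.

Lemma valid_disj (I : Type) (P Q : I -> rfun) C :
  (forall i, valid L (P i) C (Q i)) -> valid L (rsup P) C (rsup Q).
Proof.
move=> vC s p /le_rsup[i /vC[t [q [l [qQ Ll r]]]]].
by exists t, q, l; split=> //; apply/le_rsup; exists i.
Qed.

Lemma valid_constancy P Q C (B : bexpr) :
  [set` efv B] `&` [set` cmod C] = set0 -> valid L P C Q ->
  valid L (P \min ind B) C (Q \min ind B).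
Proof.
move=> disj vC s p; rewrite /= le_min => /andP[/vC[t [q [l [qQ Ll r]]]]].
rewrite /ind; case: ifPn => [Bs _|_]; last by rewrite leeNy_eq.
exists t, q, l; split=> //.
suff -> : B t = B s by rewrite Bs le_min qQ leey.
apply: eval_efv => y yB; apply: (run_frame r); apply/negP => yC.
by suff: (set0 : set var) y by []; rewrite -disj.
Qed.

(** Split [p] as [p' + d] with [p'] below [P s] and [d] below [F s], run [C] from [p'], and shift
    that run by [d]. The value of [F] survives since [C] modifies none of its variables. *)
Lemma valid_relax P Q C (F : rfun) :
  fv F `&` [set` cmod C] = set0 ->
  (forall s (l d : int), d%:E <= F s -> L l -> L (l + d)%R) ->
  valid L P C Q -> valid L (P \+ F) C (Q \+ F).
Proof.
move=> disj Lshift vC s p /=.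
have shift d p' : d%:E <= F s -> (p' + d)%R = p -> p'%:E <= P s ->
    (forall t q', F t = F s -> q'%:E <= Q t -> (q' + d)%:E <= Q t + F s) ->
    exists t q l, [/\ q%:E <= Q t + F t, L l & run C s p l t q].
  move=> dF <- /vC[t [q [l [qQ Ll r]]]] post.
  have Fts : F t = F s by apply: fv_indep disj _; exact: run_frame r.
  exists t, (q + d)%R, (l + d)%R.
  by split; [rewrite Fts; exact: post|exact: Lshift dF Ll|exact: run_shift].
case Fs : (F s) => [f| |]; last by rewrite addeNy leeNy_eq.
  move=> pP; apply: (shift f (p - f)%R); rewrite ?Fs ?subrK //.
    by rewrite EFinB leeBlDr.
  by move=> t q' _ q'Q; rewrite EFinD leeD2r.
(* With [F s = +oo] every [d] is allowed: the gap [p - m] if [P s = m], and [0] if [P s = +oo]. If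
   [P s = -oo], the sum is [-oo] and bounds no integer. After the run, [Q t] is above an integer, so
   its sum with [+oo] is [+oo]. *)
case Ps : (P s) => [m| |]; last by [].
- move=> _; apply: (shift (p - m)%R m); rewrite ?Fs ?Ps ?leey ?subrKC //.
  move=> t q' _; case: (Q t) => [k| |]; by rewrite ?leey ?leeNy_eq.
- move=> _; apply: (shift 0%R p); rewrite ?Fs ?Ps ?leey ?addr0 //.
  move=> t q' _; case: (Q t) => [k| |]; by rewrite ?leey ?leeNy_eq.
Qed.

Lemma valid_conseq P P' Q Q' C :
  rle P P' -> valid L P' C Q' -> rle Q' Q -> valid L P C Q.
Proof.
move=> PP' vC QQ' s p pP.
have [t [q [l [qQ Ll r]]]] := vC s p (le_trans pP (PP' s)).
by exists t, q, l; split=> //; exact: le_trans qQ (QQ' t).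
Qed.

(** The renaming sends [x] to [y] and fixes the rest, so it is injective away from [y]; it carries
    the run from [upd s x (s y)] to one from [s]. *)
Lemma valid_subst P Q C (x y : var) :
  ~ fv Q y -> y \notin cfv C -> valid L P C Q ->
  valid L (rsubst P x y) (csubst C x y) (rsubst Q x y).
Proof.
move=> Qy yC vC s p /vC[t [q [l [qQ Ll r]]]].
rewrite /csubst; set f := (X in cren X C).
have fx : f x = y by rewrite /f /= eqxx.
have fz z : z != x -> f z = z by rewrite /f /=; case: eqP.
clearbody f.
have sub : {subset cfv C <= predC1 y}.
  by move=> z zC; rewrite !inE; apply: contraNneq yC => <-.
have finj : {in predC1 y &, injective f}.
  move=> u v; rewrite !inE => uy vy.
  have [->|ux] := eqVneq u x; have [->|vx] := eqVneq v x => //.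
  + by rewrite fx fz // => /esym/eqP; rewrite (negbTE vy).
  + by rewrite fx fz // => /eqP; rewrite (negbTE uy).
  + by rewrite !fz.
have ss : {in predC1 y, upd s x (s y) =1 s \o f}.
  move=> z _ /=; have [->|zx] := eqVneq z x; first by rewrite fx upd_eq.
  by rewrite fz // upd_neq.
have [t' [r' tt' _]] := run_cren r sub finj ss.
exists t', q, l; split=> //.
(* The two final states may still differ at [y], which [Q] does not see. *)
rewrite /rsubst (@fv_indep _ [:: y] t) //.
  rewrite -subset0 => z /= -[Qz].
  by rewrite inE => /eqP zy; apply: Qy; rewrite -zy.
move=> z; rewrite inE => zy; rewrite (tt' z) //=.
have [->|zx] := eqVneq z x; first by rewrite fx upd_eq.
by rewrite fz // upd_neq.
Qed.

End Validity.

(** * Loops *)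

Lemma valid_loop_anylevel (P : nat -> rfun) (k : nat) (C : cmd) :
  (forall n, (n < k)%N -> valid anylevel (P n) C (P n.+1)) ->
  valid anylevel (P 0%N) (Star C) (P k).
Proof.
elim: k P => [|k IH] P step; first exact: valid_star0.
apply/valid_starS/(valid_seq (L1 := anylevel) (L2 := anylevel)) => //.
  exact: step.
by apply: (IH (fun n => P n.+1)) => n; exact: (step n.+1).
Qed.

(** Iterations of arbitrary level are peeled off until the low one, number [m], comes first; all
    later ones may again have any level, since one low half makes the minimum low. *)
Lemma valid_loop_nonpos (P : nat -> rfun) (k m : nat) (C : cmd) :
  (forall n, (n < k)%N -> valid anylevel (P n) C (P n.+1)) ->
  (m < k)%N -> valid nonpos (P m) C (P m.+1) ->
  valid nonpos (P 0%N) (Star C) (P k).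
Proof.
elim: k m P => // k IH [|m] P step mk low; apply: valid_starS.
  apply: (valid_seq (L1 := nonpos) (L2 := anylevel)) low _.
    by move=> l1 l2 l1le _; rewrite /nonpos ge_min l1le.
  by apply: (valid_loop_anylevel (P := fun n => P n.+1)) => n; exact: (step n.+1).
apply: (valid_seq (L1 := anylevel) (L2 := nonpos)) (step 0%N isT) _.
  by move=> l1 l2 _ l2le; rewrite /nonpos ge_min l2le orbT.
by apply: (IH m (fun n => P n.+1)) => // n; exact: (step n.+1).
Qed.

(** * Soundness of the two calculi *)

Lemma derB_sound (P Q : rfun) (C : cmd) : derB P C Q -> valid anylevel P C Q.
Proof.
elim=> {P C Q}.
- by move=> P; exact: valid_skip.
- by move=> P x e; exact: valid_assign.
- by move=> P B; exact: valid_assume.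
- by move=> P e; exact: valid_tick.
- by move=> P R Q C1 C2 _ v1 _ v2; apply: valid_seq v1 v2.
- by move=> P Q C1 C2 _; exact: valid_choiceL.
- by move=> P Q C1 C2 _; exact: valid_choiceR.
- by move=> P k C _; exact: valid_loop_anylevel.
- by move=> P Q x C _; exact: valid_local.
- by move=> I P Q C _; exact: valid_disj.
- by move=> P Q C B disj _; exact: valid_constancy.
- by move=> P Q C F disj _; exact: valid_relax.
- by move=> P P' Q Q' C PP' _ v; exact: valid_conseq.
- by move=> P Q C x y _ Qy yC _; exact: valid_subst.
Qed.

Lemma admits_nonpos (P : rfun) : rle P (fun=> 0) -> admits nonpos P.
Proof. by move=> P0 s p pP; have := le_trans pP (P0 s); rewrite lee_fin. Qed.

Lemma derD_sound (P Q : rfun) (C : cmd) : derD P C Q -> valid nonpos P C Q.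
Proof.
elim=> {P C Q}.
- by move=> P /admits_nonpos; exact: valid_skip.
- by move=> P x e /admits_nonpos; exact: valid_assign.
- by move=> P B /admits_nonpos; exact: valid_assume.
- by move=> P C /admits_nonpos; exact: valid_star0.
- move=> P e P0; apply: valid_tick => s p pP.
  (* The side condition makes either [P s] or [P s - e s] nonpositive, hence the resource before or
     after the tick. *)
  have := P0 s; rewrite /= /nonpos !ge_min => /orP[] h.
    by have := le_trans pP h; rewrite lee_fin => ->.
  suff: (p - e s)%:E <= 0 by rewrite lee_fin => ->; rewrite orbT.
  by apply: le_trans h; rewrite EFinB leeD2r.
- move=> P R Q C1 C2 _ v1 /derB_sound v2; apply: valid_seq v1 v2.
  by move=> l1 l2 l1le _; rewrite /nonpos ge_min l1le.
- move=> P R Q C1 C2 /derB_sound v1 _ v2; apply: valid_seq v1 v2.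
  by move=> l1 l2 _ l2le; rewrite /nonpos ge_min l2le orbT.
- by move=> P Q C1 C2 _; exact: valid_choiceL.
- by move=> P Q C1 C2 _; exact: valid_choiceR.
- move=> P k m C step mk _ low.
  by apply: valid_loop_nonpos mk low => n /step/derB_sound.
- by move=> P Q x C _; exact: valid_local.
- by move=> I P Q C _; exact: valid_disj.
- by move=> P Q C B disj _; exact: valid_constancy.
- move=> P Q C F disj F0 _; apply: valid_relax disj _ => s l d dF l0.
  (* A nonpositive [F] only allows downward shifts, which keep a level nonpositive. *)
  have d0 := admits_nonpos F0 dF; rewrite /nonpos in l0 d0 *; lia.
- by move=> P P' Q Q' C PP' _ v; exact: valid_conseq.
- by move=> P Q C x y _ Qy yC _; exact: valid_subst.
Qed.

Theorem theorem3 (P Q : rfun) (C : cmd) : derD P C Q -> validD P C Q.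
Proof.
move=> /derD_sound v s p /v[t [q [l [qQ l0 r]]]].
by exists t, q; split=> //; exists l.
Qed.
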